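(* For any $\beta>0$, $L>0$, $0<A<M$, $q\ge 1$ and $d\ge 1$, $$\liminf_{n\to\infty}\ \varphi_n^{-q}(\beta)\,R_{n,q}\big[\mathbb H_d(\beta,L,M,A)\big]>0,\qquad \varphi_n(\beta)=n^{-\frac{\beta}{\beta+d}} .$$
   Context: Model. For $n\in\mathbb N^*$ (with $n^{1/d}$ an integer; limits $n\to\infty$ are along such $n$), the deterministic design points $X_1,\dots,X_n$ are the points of the grid $\{1/n^{1/d},2/n^{1/d},\dots,1\}^d\subset[0,1]^d$. One observes $Y^{(n)}=(X_i,Y_i)_{i=1,\dots,n}$ with $Y_i=f(X_i)\,U_i$, where $U_1,\dots,U_n$ are independent and uniformly distributed on $[0,1]$ and $f:[0,1]^d\to\mathbb R$ is unknown. $\mathbb E_f$ denotes expectation under the law of $Y^{(n)}$. The goal is to estimate $f$ at a given point $y\in[0,1]^d$. An estimator is a measurable function of $Y^{(n)}$. Hölder class. For $p=(p_1,\dots,p_d)\in\mathbb N^d$ put $|p|=p_1+\dots+p_d$; $\lfloor\beta\rfloor$ is the largest integer strictly less than $\beta$. $\mathbb H_d(\beta,L,M)$ is the set of functions $f:[0,1]^d\to\mathbb R$ having on $[0,1]^d$ all partial derivatives of order $\lfloor\beta\rfloor$ and such that for all $x,z\in[0,1]^d$ $$\sum_{0\le|p|\le\lfloor\beta\rfloor}\sup_{x\in[0,1]^d}\left|\frac{\partial^{|p|}f(x)}{\partial x_1^{p_1}\cdots\partial x_d^{p_d}}\right|\le M,\qquad \left|f(x)-\sum_{0\le|p|\le\lfloor\beta\rfloor}\frac{\partial^{|p|}f(z)}{\partial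 z_1^{p_1}\cdots\partial z_d^{p_d}}\prod_{j=1}^d\frac{(x_j-z_j)^{p_j}}{p_j!}\right|\le L\sum_{j=1}^d|x_j-z_j|^\beta .$$ $\mathbb H_d(\beta,L,M,A)=\{g\in\mathbb H_d(\beta,L,M):\inf_{x\in[0,1]^d}g(x)\ge A\}$. Risk. For an estimator $\tilde f$, $R_{n,q}[\tilde f,\mathbb H_d(\beta,L,M,A)]=\sup_{f\in\mathbb H_d(\beta,L,M,A)}\mathbb E_f|\tilde f(y)-f(y)|^q$, and $R_{n,q}[\mathbb H_d(\beta,L,M,A)]=\inf_{\tilde f}R_{n,q}[\tilde f,\mathbb H_d(\beta,L,M,A)]$, the infimum being over all estimators. *)

(* Defs.v *)
From HB Require Import structures.
From mathcomp Require Export all_boot all_order all_algebra.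
From mathcomp Require Export all_classical all_reals all_analysis.

Set Implicit Arguments.
Unset Strict Implicit.
Unset Printing Implicit Defensive.

Export Order.TTheory GRing.Theory Num.Theory.
Export numFieldNormedType.Exports.

Global Open Scope classical_set_scope.
Global Open Scope ring_scope.

(* Functions on [0,1]^d are total functions on 'rV[R]_d: every definition below
   only reads their values on the cube. *)
Definition cube (R : realType) (d : nat) : set 'rV[R]_d :=
  [set x | forall j : 'I_d, 0 <= x ord0 j <= 1].

Definition pquot (R : realType) (d : nat) (j : 'I_d) (f : 'rV[R]_d -> R)
    (x : 'rV[R]_d) (h : R) : R :=
  h^-1 * (f (h *: delta_mx ord0 j + x) - f x).

(* Only increments that stay in the cube: pderive is the two-sided derivative
   in the interior and the one-sided one on the faces. *)
Definition pincr (R : realType) (d : nat) (j : 'I_d) (x : 'rV[R]_d) :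
    set_system R :=
  within [set h : R | cube (h *: delta_mx ord0 j + x)] (0 : R)^'.

Definition pderivable (R : realType) (d : nat) (j : 'I_d) (f : 'rV[R]_d -> R)
    (x : 'rV[R]_d) : Prop :=
  cvg (pquot j f x @ pincr j x).

Definition pderive (R : realType) (d : nat) (j : 'I_d) (f : 'rV[R]_d -> R) :
    'rV[R]_d -> R :=
  fun x => lim (pquot j f x @ pincr j x).

(* [:: j_1; ...; j_k] stands for d/dx_{j_1} ... d/dx_{j_k}; the rightmost
   derivative is taken first. *)
Definition pderive_seq (R : realType) (d : nat) (s : seq 'I_d)
    (f : 'rV[R]_d -> R) : 'rV[R]_d -> R :=
  foldr (@pderive R d) f s.

Definition pderive_multi (R : realType) (d k : nat) (p : {ffun 'I_d -> 'I_k.+1})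
    (f : 'rV[R]_d -> R) : 'rV[R]_d -> R :=
  pderive_seq (flatten [seq nseq (p j) j | j <- enum 'I_d]) f.

(* All partial derivatives of order k, in every order of differentiation, exist
   on the cube. *)
Definition has_pderivatives (R : realType) (d k : nat) (f : 'rV[R]_d -> R) :
    Prop :=
  forall (s : seq 'I_d) (j : 'I_d) (x : 'rV[R]_d),
    (size s < k)%N -> cube x -> pderivable j (pderive_seq s f) x.

(* The largest integer strictly less than beta (a natural number for
   beta > 0). *)
Definition sfloor (R : realType) (beta : R) : nat :=
  `|Num.ceil beta - 1|%N.

Lemma sfloorP (R : realType) (beta : R) (n : nat) :
  0 < beta -> (n <= sfloor beta)%N = (n%:R < beta).
Proof.
move=> b0; rewrite /sfloor.
have c0 : 0 <= Num.ceil beta - 1 by rewrite subr_ge0 -gtz0_ge1 ceil_gt0.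
by rewrite -lez_nat gez0_abs// lerBrDr -ltzD1 ltrD2r ceil_gt_int.
Qed.

Definition mabs (d k : nat) (p : {ffun 'I_d -> 'I_k.+1}) : nat :=
  (\sum_(j < d) p j)%N.

Definition taylor (R : realType) (d k : nat) (f : 'rV[R]_d -> R)
    (z x : 'rV[R]_d) : R :=
  \sum_(p : {ffun 'I_d -> 'I_k.+1} | (mabs p <= k)%N)
    pderive_multi p f z *
    \prod_(j < d) ((x ord0 j - z ord0 j) ^+ p j / (p j)`!%:R).

Definition holder_ball (R : realType) (d : nat) (beta L M : R) :
    set ('rV[R]_d -> R) :=
  [set f | [/\ has_pderivatives (sfloor beta) f,
    (\sum_(p : {ffun 'I_d -> 'I_(sfloor beta).+1}
             | (mabs p <= sfloor beta)%N)
       ereal_sup [set `|pderive_multi p f x|%:E | x in @cube R d]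
     <= M%:E)%E &
    forall x z : 'rV[R]_d, cube x -> cube z ->
      `|f x - taylor (sfloor beta) f z x|
        <= L * \sum_(j < d) `|x ord0 j - z ord0 j| `^ beta]].

Definition holder_ball_ge (R : realType) (d : nat) (beta L M A : R) :
    set ('rV[R]_d -> R) :=
  [set g | holder_ball beta L M g /\
    (A%:E <= ereal_inf [set (g x)%:E | x in @cube R d])%E].

Lemma card_grid (d m : nat) : #|{ffun 'I_d -> 'I_m}| = (m ^ d)%N.
Proof. by rewrite card_ffun !card_ord. Qed.

(* The points of {1/m, ..., m/m}^d, enumerated by 'I_n with n = m ^ d, that is
   m = n^(1/d). *)
Definition design (R : realType) (d m : nat) (i : 'I_(m ^ d)) : 'rV[R]_d :=
  let g : {ffun 'I_d -> 'I_m} :=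
    enum_val (cast_ord (esym (card_grid d m)) i) in
  \row_(j < d) ((g j).+1%:R / m%:R).

Definition mutually_independent (dT : measure_display) (T : measurableType dT)
    (R : realType) (P : probability T R) (I : finType)
    (X : I -> {RV P >-> R}) : Prop :=
  forall (J : {set I}) (B : I -> set R), (forall i, measurable (B i)) ->
    P (\bigcap_(i in [set` J]) (X i @^-1` B i)) =
    (\prod_(i in J) P (X i @^-1` B i))%E.

Definition uniform01 (dT : measure_display) (T : measurableType dT)
    (R : realType) (P : probability T R) (X : {RV P >-> R}) : Prop :=
  forall B : set R, measurable B ->
    distribution P X B = uniform_prob (@ltr01 R) B.

Definition responses (dT : measure_display) (T : measurableType dT)
    (R : realType) (P : probability T R) (d m : nat)
    (U : 'I_(m ^ d) -> {RV P >-> R}) (f : 'rV[R]_d -> R) (w : T) :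
    (m ^ d).-tuple R :=
  [tuple f (design R i) * U i w | i < (m ^ d)%N].

(* The design points being deterministic and known, an estimator is a
   measurable function of the responses. *)
Definition estimator (R : realType) (n : nat) : set (n.-tuple R -> R) :=
  [set t | measurable_fun [set: n.-tuple R] t].

Definition max_risk (dT : measure_display) (T : measurableType dT)
    (R : realType) (P : probability T R) (d m : nat)
    (U : 'I_(m ^ d) -> {RV P >-> R}) (q : R) (y : 'rV[R]_d)
    (F : set ('rV[R]_d -> R)) (t : (m ^ d).-tuple R -> R) : \bar R :=
  ereal_sup
    [set ('E_P[(fun w => `|t (responses U f w) - f y| `^ q)%R])%E | f in F].

Definition minimax_risk (dT : measure_display) (T : measurableType dT)
    (R : realType) (P : probability T R) (d m : nat)
    (U : 'I_(m ^ d) -> {RV P >-> R}) (q : R) (y : 'rV[R]_d)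
    (F : set ('rV[R]_d -> R)) : \bar R :=
  ereal_inf [set max_risk U q y F t | t in @estimator R (m ^ d)].

Definition rate (R : realType) (d : nat) (beta : R) (n : nat) : R :=
  n%:R `^ (- (beta / (beta + d%:R))).

(* Main.v *)
(** Compare the constant [f0 = A] with
    [f1 = A + eps h^beta prod_j psi((x_j - y_j) / h)], [h = n^(-1/(beta+d))];
    their values at [y] differ by a constant times [h^beta], the rate.  As
    [f1 >= f0], the law of the responses under [f1], restricted to the box that
    supports their law under [f0], is [c] times the latter law, where
    [c = prod_i f0(X_i) / f1(X_i) >= exp(- sum_i (f1 - f0)(X_i) / A)].  Hence
    every risk under [f1] is at least [c] times the same risk under [f0], and
    it suffices that [sum_i (f1 - f0)(X_i)] be bounded in [n].

    No compact support is needed for this, so [psi] is the logistic density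
    [s (1 - s)], [s(x) = 1 / (1 + exp(-x))].  Its derivatives are polynomials in
    [s], hence bounded, which gives the Hoelder condition for [f1].  Its sums
    along an arithmetic progression are dominated by telescoping sums of [s],
    and its sum over the grid is a product of [d] of them, at most [(2 m h)^d],
    so that [sum_i (f1 - f0)(X_i) <= 2^d eps n h^(beta+d) = 2^d eps]. *)

Require Import Defs.
From mathcomp Require Import measurable_realfun.
From mathcomp Require Import ring lra.

Set Implicit Arguments.
Unset Strict Implicit.
Unset Printing Implicit Defensive.

(** * Comparison of the laws of the responses *)

Lemma uniform_probE (R : realType) (B : set R) : measurable B ->
  uniform_prob (@ltr01 R) B = lebesgue_measure (B `&` `[0%R, 1%R]).
Proof.
move=> mB; rewrite /uniform_prob integral_uniform_pdf.
rewrite (eq_integral (fun=> 1%E)); last first.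
  by move=> x; rewrite inE/= in_itv/= => -[_]; rewrite /uniform_pdf => ->;
    rewrite subr0 invr1.
by rewrite integral_cst ?mul1e//; exact: measurableI.
Qed.

(** By uniqueness of Lebesgue measure: [r] times its image under multiplication by [r] also gives
    each interval []a, b]] its length. *)
Lemma lebesgue_measureZ (R : realType) (r : R) (B : set R) : 0 < r ->
  measurable B ->
  lebesgue_measure B = (r%:E * lebesgue_measure (( *%R r) @^-1` B))%E.
Proof.
move=> r0 mB; have mr : measurable_fun [set: R] (( *%R r) : R ->
  measurableTypeR R).
  by exact: mulrl_measurable.
pose m : {measure set measurableTypeR R -> \bar R} :=
  measure_function_pushforward__canonical__measure_function_Measure
    lebesgue_measure mr.
have := @lebesgue_measure_unique R (mscale (PosNum r0)%:num%:nng m).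
rewrite /mscale/= /pushforward => ->// _ [[a b]] _ <-/=.
rewrite /mscale/= /pushforward/=.
rewrite [X in (_ * lebesgue_measure X)%E](_ : _ = `]a / r, b / r]%classic);
  last first.
  by apply/seteqP; split => x /=;
    rewrite !in_itv/= ltr_pdivrMr// ler_pdivlMr// ![x * r]mulrC.
rewrite !lebesgue_measure_itv/= !lte_fin ltr_pM2r ?invr_gt0//.
case: ifPn => _; last by rewrite mule0.
by rewrite -!EFinB -mulrBl -EFinM mulrCA divff ?mulr1// gt_eqF.
Qed.

(** A uniform variable is at most [r] with probability [r], and given this event it is distributed
    as [r] times a uniform variable. *)
Lemma uniform_probZ (R : realType) (r : R) (B : set R) : 0 < r <= 1 ->
  measurable B ->
  uniform_prob (@ltr01 R) (B `&` `]-oo, r]) =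
  (r%:E * uniform_prob (@ltr01 R) (( *%R r) @^-1` B))%E.
Proof.
move=> /andP[r0 r1] mB.
have mrB : measurable (( *%R r) @^-1` B : set R).
  by rewrite -[X in measurable X]setTI; exact: mulrl_measurable.
rewrite !uniform_probE//; last exact: measurableI.
rewrite (@lebesgue_measureZ _ r)//; last by do 2?apply: measurableI.
congr (_ * lebesgue_measure _)%E; apply/seteqP; split => x /=;
  rewrite !in_itv/=.
  move=> [[Bx rx1] /andP[rx0 _]]; split => //.
  by rewrite -(pmulr_rge0 _ r0) rx0 -(ler_pM2l r0) mulr1.
move=> [Bx /andP[x0 x1]]; split; first split => //.
  by rewrite -[leRHS]mulr1 ler_pM2l.
by rewrite mulr_ge0 ?(ltW r0)//= mulr_ile1// ltW.
Qed.

(** The responses with arbitrary scales [a i] in place of [f (design R i)]: the comparison of laws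
    sees [f] only through these values. *)
Definition scaled (dT : measure_display) (T : measurableType dT) (R : realType)
  (n : nat) (X : 'I_n -> T -> R) (a : 'I_n -> R) (w : T) : n.-tuple R :=
  [tuple a i * X i w | i < n].

Lemma measurable_scaled (dT : measure_display) (T : measurableType dT)
  (R : realType) (P : probability T R) (n : nat) (X : 'I_n -> {RV P >-> R})
  (a : 'I_n -> R) :
  measurable_fun [set: T] (scaled X a).
Proof.
apply/measurable_fun_tnthP => i.
rewrite (_ : _ \o _ = (fun w => a i * X i w)); last first.
  by apply/funext => w /=; rewrite tnth_mktuple.
exact: measurable_funM.
Qed.

Definition box (R : realType) (n : nat) (B : 'I_n -> set R) : set (n.-tuple R)
  :=
  [set v | forall i, B i (tnth v i)].

Definition boxes (R : realType) (n : nat) : set_system (n.-tuple R) :=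
  [set box B | B in [set B : 'I_n -> set R | forall i, measurable (B i)]].

Lemma measurable_box (R : realType) (n : nat) (B : 'I_n -> set R) :
  (forall i, measurable (B i)) -> measurable (box B).
Proof.
move=> mB; rewrite (_ : box B = \bigcap_i ((@tnth n R ^~ i) @^-1` B i));
  last first.
  by apply/seteqP; split => [v Bv i _|v Bv i]; exact: Bv.
apply: fin_bigcap_measurable => // i _; rewrite -[X in measurable X]setTI.
exact: measurable_tnth.
Qed.

Lemma boxes_setI_closed (R : realType) (n : nat) : setI_closed (@boxes R n).
Proof.
move=> _ _ [B mB <-] [C mC <-]; exists (fun i => B i `&` C i).
  by move=> i; exact: measurableI.
apply/seteqP; split => v; first by move=> BC; split => i; have [] := BC i.
by move=> [Bv Cv] i; split; [exact: Bv|exact: Cv].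
Qed.

(** A coordinate cylinder is a box whose other sides are full, so the boxes form a generating
    pi-system and determine finite measures. *)
Lemma measurable_tupleE (R : realType) (n : nat) :
  @measurable _ (n.-tuple R) = <<s @boxes R n >>.
Proof.
apply/seteqP; split; last first.
  apply: smallest_sub; first exact: sigma_algebra_measurable.
  by move=> _ [B mB <-]; exact: measurable_box.
apply: smallest_sub; first exact: smallest_sigma_algebra.
rewrite -bigcup_seq; apply: bigcup_sub => i _ _ [B mB <-].
apply: sub_sigma_algebra; exists (fun j => if j == i then B else setT).
  by move=> j; case: ifP.
apply/seteqP; split => v /=.
  by move=> /(_ i); rewrite eqxx.
by move=> [_ Bv] j; case: ifP => // /eqP ->.
Qed.

Lemma probability_box (dT : measure_display) (T : measurableType dT)
    (R : realType) (P : probability T R) (n : nat) (X : 'I_n -> {RV P >-> R})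
    (a : 'I_n -> R) (B : 'I_n -> set R) :
  mutually_independent X -> (forall i, uniform01 (X i)) ->
  (forall i, measurable (B i)) ->
  P (scaled X a @^-1` box B) =
  (\prod_(i < n) uniform_prob (@ltr01 R) (( *%R (a i)) @^-1` B i))%E.
Proof.
move=> indX unifX mB.
have maB i : measurable (( *%R (a i)) @^-1` B i : set R).
  by rewrite -[X in measurable X]setTI; exact: mulrl_measurable.
rewrite (_ : _ @^-1` _ =
    \bigcap_(i in [set` [set: 'I_n]%SET]) (X i @^-1` (( *%R (a i)) @^-1` B i))).
  rewrite indX//; apply: eq_big => [i|i _]; first by rewrite inE.
  by rewrite -(unifX i _ (maB i)).
apply/seteqP; split => [w Bw i _|w Bw i].
  by have := Bw i; rewrite tnth_mktuple.
by rewrite tnth_mktuple; apply: Bw; rewrite /= inE.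
Qed.

(* On the event that the responses with the larger scales [b] fit into the box
   of side lengths [a], they are distributed as those with scales [a]. *)
Lemma scaled_dominated (dT : measure_display) (T : measurableType dT)
    (R : realType) (P : probability T R) (n : nat) (X : 'I_n -> {RV P >-> R})
    (a b : 'I_n -> R) (B : set (n.-tuple R)) :
  mutually_independent X -> (forall i, uniform01 (X i)) ->
  (forall i, 0 < a i <= b i) -> measurable B ->
  ((\prod_(i < n) (a i / b i))%:E * P (scaled X a @^-1` B) <=
   P (scaled X b @^-1` B))%E.
Proof.
move=> indX unifX ab mB.
have a0 i : 0 < a i by case/andP: (ab i).
have b0 i : 0 < b i by case/andP: (ab i) => ? ; exact: lt_le_trans.
have c0 : 0 <= \prod_(i < n) (a i / b i).
  by apply: prodr_ge0 => i _; rewrite divr_ge0// ltW.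
pose D := box (fun i => `]-oo, a i]%classic).
have mD : measurable D by exact: measurable_box.
pose ma := measure_function_pushforward__canonical__measure_function_Measure P
  (measurable_scaled X a).
pose mb := measure_function_pushforward__canonical__measure_function_Measure P
  (measurable_scaled X b).
have -> : ((\prod_(i < n) (a i / b i))%:E * P (scaled X a @^-1` B) =
    P (scaled X b @^-1` (B `&` D)))%E; last first.
  apply: le_measure; rewrite ?inE//.
  + rewrite -[X in measurable X]setTI; apply: measurable_scaled => //.
    exact: measurableI.
  + by rewrite -[X in measurable X]setTI; exact: measurable_scaled.
  + by move=> w [].
(* Both sides are finite measures in [B], so they need only agree on boxes, where independence makes
   them products. *)
apply: (@measure_unique _ R (n.-tuple R) (@boxes R n) (fun=> setT)
  (measurable_tupleE R n) (@boxes_setI_closed R n) _ _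
  (mscale (NngNum c0) ma) (mrestr mb mD)) => //.
- move=> _; exists (fun=> setT); first by move=> i; exact: measurableT.
  by apply/seteqP; split.
- by rewrite bigcup_const.
- move=> _ [C mC <-]; rewrite /mscale/mrestr/= /pushforward.
  rewrite [X in _ = P (_ @^-1` X)](_ : _ =
      box (fun i => C i `&` `]-oo, a i]%classic)); last first.
    apply/seteqP; split => [v [Cv Dv] i|v CDv].
      by split; [exact: Cv|exact: Dv].
    by split => i; have [] := CDv i.
  rewrite [LHS](_ : _ =
    (\prod_(i < n) (a i / b i))%:E * P (scaled X a @^-1` box C))%E//.
  rewrite !probability_box//; last by move=> i; exact: measurableI.
  rewrite -prodEFin -big_split/=; apply: eq_bigr => i _.
  (* [b i * x <= a i] means [x <= a i / b i]; conditioning at this level yields the factor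
     [a i / b i] and turns the scale [b i] into [a i]. *)
  have -> : ( *%R (b i)) @^-1` (C i `&` `]-oo, a i]) =
            (( *%R (b i)) @^-1` (C i)) `&` `]-oo, a i / b i]%classic.
    by apply/seteqP; split => x /=; rewrite !in_itv/= ler_pdivlMr// mulrC.
  rewrite uniform_probZ//.
  + congr (_ * uniform_prob _ _)%E; apply/funext => x /=.
    by rewrite mulrA mulrCA divff ?mulr1// gt_eqF.
  + by rewrite divr_gt0//= ler_pdivrMr// mul1r; case/andP: (ab i).
  + by rewrite -[X in measurable X]setTI; exact: mulrl_measurable.
- move=> _.
  suff : ((\prod_(i < n) (a i / b i))%:E * P (scaled X a @^-1` setT) < +oo)%E
    by [].
  by rewrite preimage_setT probability_setT mule1 ltry.
Qed.

(** Both expectations are integrals of [g] over laws on tuples, and domination of measures passes to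
    integrals of a nonnegative function. *)
Lemma expectation_dominated (dT : measure_display) (T : measurableType dT)
    (R : realType) (P : probability T R) (n : nat) (X : 'I_n -> {RV P >-> R})
    (a b : 'I_n -> R) (g : n.-tuple R -> R) :
  mutually_independent X -> (forall i, uniform01 (X i)) ->
  (forall i, 0 < a i <= b i) ->
  measurable_fun setT g -> (forall v, 0 <= g v) ->
  ((\prod_(i < n) (a i / b i))%:E * 'E_P[(g \o scaled X a)%R] <=
   'E_P[(g \o scaled X b)%R])%E.
Proof.
move=> indX unifX ab mg g0.
have c0 : 0 <= \prod_(i < n) (a i / b i).
  apply: prodr_ge0 => i _; case/andP: (ab i) => a0 /(lt_le_trans a0) b0.
  by rewrite divr_ge0// ltW.
pose law (c : 'I_n -> R) :=
  measure_function_pushforward__canonical__measure_function_Measure P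
    (measurable_scaled X c).
have mg' : measurable_fun setT (EFin \o g) by exact/measurable_EFinP.
have expE c : ('E_P[(g \o scaled X c)%R] = \int[law c]_v (EFin \o g) v)%E.
  rewrite (ge0_integral_pushforward (measurable_scaled X c))//;
    last by move=> v _; rewrite lee_fin.
  by rewrite unlock preimage_setT.
rewrite !expE.
rewrite -(ge0_integral_mscale _ measurableT (NngNum c0))//; last first.
  by move=> v _; rewrite /= lee_fin.
apply: ge0_le_measure_integral => // S mS.
suff : ((\prod_(i < n) (a i / b i))%:E * P (scaled X a @^-1` S) <=
        P (scaled X b @^-1` S))%E by [].
exact: scaled_dominated.
Qed.

(** * Taylor's formula and the logistic density *)

(** The bound on [df] is asked on the whole ball around [v], so that [u < v] and [v <= u] share one
    hypothesis. *)
Lemma mean_value_bound (R : realType) (f df : R -> R) (C u v : R) :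
  (forall x : R, is_derive x 1 f (df x)) ->
  (forall x, `|x - v| <= `|u - v| -> `|df x| <= C) ->
  `|f u - f v| <= C * `|u - v|.
Proof.
move=> fdf dfC.
have cf (a b : R) : {within `[a, b], continuous f}.
  by apply: derivable_within_continuous => x _;
    exact: (@ex_derive _ _ _ _ _ _ _ (fdf x)).
have [vu|uv] := leP v u.
  have [c + ->] := MVT_segment vu (fun x _ => fdf x) (cf v u).
  rewrite in_itv/= => /andP[vc cu]; rewrite normrM ler_wpM2r//.
  by apply: dfC; rewrite !ger0_norm ?subr_ge0// lerD2r.
have [c + E] := MVT_segment (ltW uv) (fun x _ => fdf x) (cf u v).
rewrite in_itv/= => /andP[uc cv]; rewrite distrC E normrM distrC ler_wpM2r//.
by apply: dfC; rewrite !(distrC _ v) !ger0_norm ?subr_ge0 ?(ltW uv)// lerD2l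
  lerN2.
Qed.

(** With [phi] listing successive derivatives, this is the Taylor polynomial of [phi i] at [v] with
    [k] terms; as a polynomial it can be differentiated formally. *)
Definition taylor_poly (R : realType) (phi : nat -> R -> R) (k i : nat) (v : R)
  :
    {poly R} :=
  \sum_(l < k) (phi (i + l)%N v / l`!%:R) *: ('X - v%:P) ^+ l.

Lemma horner_taylor_poly (R : realType) (phi : nat -> R -> R) k i (v t : R) :
  (taylor_poly phi k i v).[t] =
  \sum_(l < k) phi (i + l)%N v * ((t - v) ^+ l / l`!%:R).
Proof.
rewrite /taylor_poly horner_sum; apply: eq_bigr => l _.
by rewrite hornerZ horner_exp hornerXsubC mulrAC mulrA.
Qed.

Lemma deriv_taylor_poly (R : realType) (phi : nat -> R -> R) k i (v : R) :
  (taylor_poly phi k.+1 i v)^`() = taylor_poly phi k i.+1 v.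
Proof.
rewrite /taylor_poly big_ord_recl/= derivD derivZ expr0 derivC scaler0 add0r.
rewrite raddf_sum/=; apply: eq_bigr => l _.
rewrite derivZ deriv_exp derivXsubC mul1r -scalerMnr scalerMnl.
congr (_ *: _); rewrite /bump/= add1n addSnnS factS natrM -mulr_natr.
by field; rewrite nat1r !pnatr_eq0 -lt0n fact_gt0.
Qed.

(** Induction on [k]: the remainder of [phi i] with [k.+1] terms vanishes at [v], and its derivative
    is the remainder of [phi i.+1] with [k] terms. The mean value bound raises the exponent by one
    and keeps the constant [B]. *)
Lemma taylor_bound (R : realType) (phi : nat -> R -> R) (B : R) (K : nat) :
  (forall i (x : R), is_derive x 1 (phi i) (phi i.+1 x)) ->
  (forall i x, (i <= K)%N -> `|phi i x| <= B) ->
  forall k i, (i + k <= K)%N -> forall u v,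
  `|phi i u - \sum_(l < k) phi (i + l)%N v * ((u - v) ^+ l / l`!%:R)| <=
    B * `|u - v| ^+ k.
Proof.
move=> dphi phiB k i ikK u v; rewrite -horner_taylor_poly.
have B0 : 0 <= B by apply: le_trans (phiB 0%N 0 _).
elim: k i ikK u => [|k IHk] i ikK u.
  rewrite /taylor_poly big_ord0 horner0 subr0 expr0 mulr1.
  by apply: phiB; rewrite addn0 in ikK.
have T0 : (taylor_poly phi k.+1 i v).[v] = phi i v.
  rewrite horner_taylor_poly big_ord_recl/= big1 => [|l _].
    by rewrite expr0 fact0 divr1 mulr1 addn0 addr0.
  by rewrite subrr expr0n/= mul0r mulr0.
have := @mean_value_bound R (fun t => phi i t - (taylor_poly phi k.+1 i v).[t])
  (fun t => phi i.+1 t - (taylor_poly phi k i.+1 v).[t]) (B * `|u - v| ^+ k) u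
    v.
rewrite T0 subrr subr0 exprSr mulrA; apply.
  move=> x; rewrite -deriv_taylor_poly.
  exact: (@is_deriveB _ _ _ (phi i) (horner (taylor_poly phi k.+1 i v))).
move=> x xu; apply: (le_trans (IHk i.+1 _ x)); first by rewrite addSnnS.
by rewrite ler_wpM2l// lerXn2r ?nnegrE.
Qed.

(** * The logistic function, its derivatives and its sums along progressions *)

Definition sigmoid (R : realType) (x : R) : R := (1 + expR (- x))^-1.

Lemma sigmoid_den_gt0 (R : realType) (x : R) : 0 < 1 + expR (- x).
Proof. by rewrite addr_gt0// expR_gt0. Qed.

Lemma sigmoid01 (R : realType) (x : R) : 0 < sigmoid x < 1.
Proof.
rewrite invr_gt0 sigmoid_den_gt0/= invf_lt1 ?sigmoid_den_gt0//.
by rewrite ltrDl expR_gt0.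
Qed.

Lemma is_derive_sigmoid (R : realType) (x : R) :
  is_derive x 1 (@sigmoid R) (sigmoid x - sigmoid x ^+ 2).
Proof.
have d0 : 1 + expR (- x) != 0 by rewrite gt_eqF// sigmoid_den_gt0.
have dN : is_derive x 1 (fun y : R => - y) (- 1).
  exact: (@is_deriveN _ _ _ id).
have dE : is_derive x 1 (fun y : R => 1 + expR (- y)) (- expR (- x)).
  have dE := @is_derive1_comp _ expR (fun y : R => - y) x _ _ (is_derive_expR
    _) dN.
  have := is_deriveD (is_derive_cst (1 : R) x (1 : R)) dE.
  by rewrite add0r mulrN1.
apply: is_derive_eq; first exact: (@is_deriveV R (fun y => 1 + expR (- y)) x _
  _ d0 dE).
by rewrite /sigmoid /GRing.scale/=; field.
Qed.

Definition bell_poly (R : realType) (i : nat) : {poly R} :=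
  iter i (fun p => p^`() * ('X - 'X^2)) ('X - 'X^2).

(* The logistic equation [s' = s - s^2] turns differentiation of [p(s)] into
   an operation on the polynomial [p]. *)
Definition bell (R : realType) (i : nat) (x : R) : R :=
  (bell_poly R i).[sigmoid x].

Lemma is_derive_bell (R : realType) (i : nat) (x : R) :
  is_derive x 1 (@bell R i) (bell i.+1 x).
Proof.
have := @is_derive1_comp _ _ _ _ _ _
  (is_derive_poly (bell_poly R i) (sigmoid x)) (is_derive_sigmoid x).
move/is_derive_eq; apply.
by rewrite /bell/= hornerM !hornerE.
Qed.

Lemma horner_unit_bound (R : realType) (p : {poly R}) (x : R) : 0 <= x <= 1 ->
  `|p.[x]| <= \sum_(l < size p) `|p`_l|.
Proof.
move=> /andP[x0 x1]; rewrite horner_coef.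
apply: le_trans (ler_norm_sum _ _ _) _; apply: ler_sum => l _.
by rewrite normrM ler_piMr// ger0_norm ?exprn_ge0// exprn_ile1.
Qed.

(** [sigmoid] takes values in [[0, 1]], where a polynomial is at most the sum of the absolute values
    of its coefficients. *)
Lemma bell_bounded (R : realType) (K : nat) :
  exists2 B : R, 1 <= B & forall i x, (i <= K)%N -> `|@bell R i x| <= B.
Proof.
pose S i : R := \sum_(l < size (bell_poly R i)) `|(bell_poly R i)`_l|.
have S0 i : 0 <= S i by exact: sumr_ge0.
exists (1 + \sum_(i < K.+1) S i); first by rewrite lerDl sumr_ge0.
move=> i x iK; apply: (@le_trans _ _ (S i)).
  by apply: horner_unit_bound; case/andP: (sigmoid01 x) => ? ?; rewrite !ltW.
rewrite (bigD1 (Ordinal (iK : (i < K.+1)%N)))//= addrCA lerDl.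
by rewrite addr_ge0// sumr_ge0.
Qed.

Lemma bell0E (R : realType) (x : R) : bell 0 x = sigmoid x * (1 - sigmoid x).
Proof. by rewrite /bell/= !hornerE mulrBr mulr1. Qed.

Lemma bell0_gt0 (R : realType) (x : R) : 0 < bell 0 x.
Proof.
by rewrite bell0E; case/andP: (sigmoid01 x) => ? ?; rewrite mulr_gt0// subr_gt0.
Qed.

Lemma bell00 (R : realType) : bell 0 (0 : R) = 4^-1.
Proof. by rewrite bell0E /sigmoid oppr0 expR0; field. Qed.

(** With [E = exp(-x)] and [F = exp(-s)], the increment of [sigmoid] is
    [E (1 - F) / ((1 + E F) (1 + E))], to be compared with [E / (1 + E)^2]; here [1 + E F <= 1 + E]
    and [1 - F >= s / 2]. *)
Lemma bell0_le_increment (R : realType) (x s : R) : 0 < s <= 1 ->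
  bell 0 x <= 2 / s * (sigmoid (x + s) - sigmoid x).
Proof.
move=> /andP[s0 s1].
have e0 := expR_gt0 (- x); have f0 := expR_gt0 (- s).
have f1 : expR (- s) <= (1 + s)^-1.
  by rewrite expRN lef_pV2 ?posrE ?expR_gt0 ?addr_gt0// expR_ge1Dx.
(* From [exp(-s) <= 1 / (1 + s)]; this is where [s <= 1] enters. *)
have f2 : s / 2 <= 1 - expR (- s).
  rewrite lerBrDl -lerBrDr; apply: (le_trans f1).
  rewrite -[leLHS]mul1r ler_pdivrMr ?addr_gt0//; nra.
have f3 : expR (- s) <= 1 by rewrite expR_le1 lerNl oppr0 ltW.
rewrite bell0E /sigmoid opprD expRD.
set E := expR (- x) in e0 *; set F := expR (- s) in f0 f1 f2 f3 *.
have d0 : 0 < 1 + E by rewrite addr_gt0.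
have d1 : 0 < 1 + E * F by rewrite addr_gt0// mulr_gt0.
have -> : 2 / s * ((1 + E * F)^-1 - (1 + E)^-1) =
    (E / (1 + E)) * (1 + E * F)^-1 * (2 / s * (1 - F)).
  by field; rewrite !gt_eqF.
have -> : (1 + E)^-1 * (1 - (1 + E)^-1) = E / (1 + E) * (1 + E)^-1.
  by field; rewrite gt_eqF.
have ge1 : 1 <= 2 / s * (1 - F).
  by rewrite mulrAC ler_pdivlMr// mul1r; lra.
have w0 : 0 <= E / (1 + E) by rewrite divr_ge0 ?ltW.
apply: (@le_trans _ _ (E / (1 + E) * (1 + E * F)^-1)).
  by rewrite ler_wpM2l// lef_pV2 ?posrE// lerD2l ler_piMr// ltW.
by rewrite ler_peMr// mulr_ge0// invr_ge0 ltW.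
Qed.

(** The increments of [sigmoid] telescope to a difference of two of its values, hence below 1,
    whatever [x] and [m]. *)
Lemma bell_sum_le (R : realType) (x s : R) (m : nat) : 0 < s <= 1 ->
  \sum_(i < m) bell 0 (x + i%:R * s) <= 2 / s.
Proof.
move=> s01; have /andP[s0 _] := s01.
pose g i := sigmoid (x + i%:R * s).
apply: (@le_trans _ _ (2 / s * (g m - g 0%N))).
  rewrite -(@telescope_sumr _ 0 m g)// mulr_sumr big_mkord.
  apply: ler_sum => i _;
    rewrite /g -(@natr1 R i) [(_ + 1) * s]mulrDl mul1r addrA.
  exact: bell0_le_increment.
rewrite ler_piMr ?divr_ge0 ?ltW//.
by have := sigmoid01 (x + m%:R * s); have := sigmoid01 (x + 0%:R * s);
  rewrite /g; lra.
Qed.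

(** * Partial derivatives and Taylor expansions of tensor products *)

Lemma prod_norm_le (R : realType) (n : nat) (a b : 'I_n -> R) :
  (forall i, `|a i| <= b i) -> `|\prod_(i < n) a i| <= \prod_(i < n) b i.
Proof.
by move=> ab; rewrite normr_prod; apply: ler_prod => i _; rewrite normr_ge0 ab.
Qed.

(** The factors are exchanged one at a time, each exchange costing [C] times a product of [n - 1]
    factors, which [1 <= B] allows to bound by [B ^+ n]. *)
Lemma prod_diff_le (R : realType) (n : nat) (B C : R) (a b : 'I_n -> R) :
  1 <= B -> 0 <= C -> (forall i, `|a i| <= B) -> (forall i, `|b i| <= B) ->
  (forall i, `|a i - b i| <= C) ->
  `|\prod_(i < n) a i - \prod_(i < n) b i| <= n%:R * C * B ^+ n.
Proof.
move=> B1 C0; have B0 : 0 <= B := le_trans ler01 B1.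
elim: n a b => [|n IHn] a b aB bB abC.
  by rewrite !big_ord0 subrr normr0 !mul0r.
rewrite !big_ord_recr/=.
set pa := \prod_(_ < _) _; set pb := \prod_(_ < _) b _.
have -> : pa * a ord_max - pb * b ord_max =
    (pa - pb) * a ord_max + pb * (a ord_max - b ord_max) by ring.
have pbB : `|pb| <= B ^+ n.+1.
  apply: (@le_trans _ _ (\prod_(i < n) B)); first exact: prod_norm_le.
  by rewrite prodr_const card_ord ler_weXn2l.
apply: le_trans (ler_normD _ _) _; rewrite !normrM.
rewrite -natr1 mulrDl mulrDl mul1r; apply: lerD.
  by rewrite exprSr mulrA; apply: ler_pM => //; exact: IHn.
by rewrite mulrC; apply: ler_pM.
Qed.

Lemma sum_le_card (R : realType) (T : finType) (P : pred T) (F : T -> R) (X :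
  R) :
  0 <= X -> (forall t, P t -> F t <= X) ->
  \sum_(t | P t) F t <= #|T|%:R * X.
Proof.
move=> X0 FX; apply: (@le_trans _ _ (\sum_(t | P t) X)); first exact: ler_sum.
by rewrite sumr_const mulr_natl ler_wpMn2l// max_card.
Qed.

Lemma monomial_le (R : realType) (d k : nat) (p : {ffun 'I_d -> 'I_k.+1})
    (g w : 'I_d -> R) (B W : R) :
  (forall j, `|g j| <= B) -> (forall j, `|w j| <= W) ->
  `|\prod_(j < d) (g j * (w j ^+ p j / (p j)`!%:R))| <= B ^+ d * W ^+ mabs p.
Proof.
move=> gB wW; apply: (@le_trans _ _ (\prod_(j < d) (B * W ^+ p j))).
  apply: prod_norm_le => j; rewrite normrM ler_pM// normrM normrX.
  rewrite normfV normr_nat ler_pdivrMr ?ltr0n ?fact_gt0//.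
  apply: (@le_trans _ _ (W ^+ p j)).
    by rewrite lerXn2r ?nnegrE// (le_trans _ (wW j)).
  rewrite ler_peMr ?ler1n ?fact_gt0// exprn_ge0// (le_trans _ (wW j))//.
by rewrite big_split/= prodr_const card_ord prodrXr.
Qed.

(** With [W] the largest [|u j - v j|], the error is at most a constant times [W ^+ k.+1] if
    [W <= 1] and [W ^+ k] if [W > 1]; as [k < beta <= k + 1], both are at most [W] to the power
    [beta]. *)
Lemma tensor_taylor_bound (R : realType) (d k : nat) (phi : nat -> R -> R)
    (B beta : R) :
  (0 < d)%N -> k%:R < beta <= k.+1%:R ->
  (forall i (x : R), is_derive x 1 (phi i) (phi i.+1 x)) ->
  1 <= B -> (forall i x, (i <= k.+1)%N -> `|phi i x| <= B) ->
  exists2 C : R, 0 < C & forall u v : 'I_d -> R,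
  `|\prod_(j < d) phi 0%N (u j) -
    \sum_(p : {ffun 'I_d -> 'I_k.+1} | (mabs p <= k)%N)
      \prod_(j < d) (phi (p j) (v j) * ((u j - v j) ^+ p j / (p j)`!%:R))|
    <= C * \sum_(j < d) `|u j - v j| `^ beta.
Proof.
case: d => // d _ /andP[kbeta betak] dphi B1 phiB.
have B0 : 0 <= B := le_trans ler01 B1.
pose N : R := #|{ffun 'I_d.+1 -> 'I_k.+1}|%:R.
(* Bounds a one-variable Taylor polynomial of [k.+1] terms when [W <= 1]. *)
pose B' := k.+1%:R * B.
have BB' : B <= B' by rewrite ler_peMl// ler1n.
have N0 : 0 <= N by [].
(* The three summands pay for replacing factors by their Taylor polynomials (when [W <= 1]), for at
   most [N] monomials, and for the product itself (when [W > 1]). *)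
exists (d.+1%:R * B * B' ^+ d.+1 + N * B ^+ d.+1 + B ^+ d.+1).
  have : 0 < B ^+ d.+1 by rewrite exprn_gt0// (lt_le_trans ltr01).
  apply: ltr_wpDl; rewrite addr_ge0// mulr_ge0 ?exprn_ge0// ?mulr_ge0//.
move=> u v; pose w j := u j - v j.
have [j0 _ maxw] := arg_maxP (fun j => `|w j|) (isT : xpredT (ord0 : 'I_d.+1)).
set W := `|w j0|.
have W0 : 0 <= W by rewrite normr_ge0.
have wW j : `|w j| <= W by exact: maxw.
apply: (@le_trans _ _ ((d.+1%:R * B * B' ^+ d.+1 + N * B ^+ d.+1 + B ^+ d.+1) *
    W `^ beta)); last first.
  rewrite ler_wpM2l//; last by rewrite (bigD1 j0)//= lerDl sumr_ge0// => *;
    exact: powR_ge0.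
  by rewrite !addr_ge0 ?mulr_ge0 ?exprn_ge0 ?mulr_ge0.
have Wb0 : 0 <= W `^ beta by exact: powR_ge0.
pose F (p : {ffun 'I_d.+1 -> 'I_k.+1}) :=
  \prod_(j < d.+1) (phi (p j) (v j) * ((u j - v j) ^+ p j / (p j)`!%:R)).
have FW p : `|F p| <= B ^+ d.+1 * W ^+ mabs p.
  by apply: monomial_le => // j; apply: phiB; rewrite ltnW.
rewrite -!mulrA !mulrDl.
have [W1|W1] := leP W 1.
  (* The product of the one-variable Taylor polynomials expands into the multivariate one plus
     monomials of total degree above [k], each of order [W ^+ k.+1]. *)
  pose T j := \sum_(l < k.+1) phi (0 + l)%N (v j) * ((u j - v j) ^+ l / l`!%:R).
  have prodT : \prod_j T j = \sum_(p | (mabs p <= k)%N) F p +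
                             \sum_(p | ~~ (mabs p <= k)%N) F p.
    by rewrite /T bigA_distr_bigA (bigID (fun p : {ffun _ -> _} => (mabs p <=
      k)%N)).
  have Wk : W ^+ k.+1 <= W `^ beta.
    have [->|Wn0] := eqVneq W 0; first by rewrite expr0n/= powR_ge0.
    rewrite -powR_mulrn// ger_powR// lt_neqAle eq_sym Wn0/= W0//.
  have TB j : `|T j| <= B'.
    apply: le_trans (ler_norm_sum _ _ _) _.
    have := @sum_le_card R 'I_k.+1 xpredT; rewrite card_ord; apply => // l _.
    have wl : `|u j - v j| <= 1 := le_trans (wW j) W1.
    rewrite normrM -[leRHS]mulr1 ler_pM//; first by apply: phiB;
      exact: ltnW (ltn_ord l).
    rewrite normrM normrX normfV normr_nat ler_pdivrMr ?ltr0n ?fact_gt0//.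
    by rewrite mul1r (@le_trans _ _ 1) ?exprn_ile1// ler1n fact_gt0.
  have -> : \prod_(j < d.+1) phi 0%N (u j) - \sum_(p | (mabs p <= k)%N) F p =
    (\prod_(j < d.+1) phi 0%N (u j) - \prod_j T j) +
    \sum_(p | ~~ (mabs p <= k)%N) F p by rewrite prodT; ring.
  apply: le_trans (ler_normD _ _) _; rewrite -[leLHS]addr0; apply: lerD;
    last first.
    by rewrite mulr_ge0// exprn_ge0.
  apply: lerD.
    apply: (@le_trans _ _ (d.+1%:R * (B * W ^+ k.+1) * B' ^+ d.+1)).
      apply: prod_diff_le => // [||j|j].
      - exact: le_trans BB'.
      - by rewrite mulr_ge0// exprn_ge0.
      - by apply: le_trans BB'; exact: phiB.
      - apply: (le_trans (@taylor_bound R phi B k.+1 dphi phiB k.+1 0%N (leqnn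
        _) (u j) (v j))).
        by rewrite ler_wpM2l// lerXn2r ?nnegrE//; exact: wW.
    have -> : d.+1%:R * (B * W ^+ k.+1) * B' ^+ d.+1 =
       (d.+1%:R * (B * B' ^+ d.+1)) * W ^+ k.+1 by ring.
    by rewrite ler_wpM2l// !mulr_ge0// exprn_ge0// (le_trans B0).
  apply: le_trans (ler_norm_sum _ _ _) _; rewrite -mulrA.
  apply: sum_le_card => [|p]; first by rewrite mulr_ge0// exprn_ge0.
  rewrite -ltnNge => kp; apply: (le_trans (FW p)).
  rewrite ler_wpM2l ?exprn_ge0//; apply: le_trans Wk.
  exact: ler_wiXn2l.
have Wk p : (p <= k)%N -> W ^+ p <= W `^ beta.
  move=> pk; rewrite -powR_mulrn// ler_powR ?ltW//.
  by apply: le_lt_trans kbeta; rewrite ler_nat.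
apply: le_trans (ler_normB _ _) _; rewrite addrC -addrA; apply: ler_wpDl.
  by rewrite mulr_ge0// mulr_ge0// mulr_ge0// exprn_ge0// (le_trans B0).
apply: lerD.
  apply: le_trans (ler_norm_sum _ _ _) _; rewrite -mulrA.
  apply: sum_le_card => [|p pk]; first by rewrite mulr_ge0// exprn_ge0.
  by apply: (le_trans (FW p)); rewrite ler_wpM2l ?exprn_ge0// Wk.
apply: (@le_trans _ _ (\prod_(j < d.+1) B)).
  by apply: prod_norm_le => j; exact: phiB.
by rewrite prodr_const card_ord ler_peMr ?exprn_ge0// -(expr0 W) Wk.
Qed.

(** * Iterated partial derivatives within the cube *)

(** Arbitrarily small nonzero steps along axis [j] stay in the cube, forwards if the coordinate is
    at most 1/2 and backwards otherwise. This makes the limits defining [pderive] unique. *)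
Lemma pincr_proper (R : realType) (d : nat) (j : 'I_d) (x : 'rV[R]_d) :
  cube x -> ProperFilter (pincr j x).
Proof.
move=> cx; apply: Build_ProperFilter_ex => P.
rewrite /pincr /within/= => -[e /= e0 eP].
have := cx j; set t := x ord0 j => /andP[t0 t1].
have [h [h0 he th]] : exists h : R, [/\ h != 0, `|h| < e & 0 <= h + t <= 1].
  have [t2|t2] := leP t 2^-1.
    exists (Num.min (e / 2) 2^-1).
    have m0 : 0 < Num.min (e / 2) (2^-1 : R) by rewrite lt_min divr_gt0/=.
    have me : Num.min (e / 2) (2^-1 : R) <= e / 2 by rewrite ge_min lexx.
    have m2 : Num.min (e / 2) (2^-1 : R) <= 2^-1 by rewrite ge_min lexx orbT.
    rewrite gt_eqF// gtr0_norm//; split => //; lra.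
  exists (- Num.min (e / 2) 2^-1).
  have m0 : 0 < Num.min (e / 2) (2^-1 : R) by rewrite lt_min divr_gt0/=.
  have me : Num.min (e / 2) (2^-1 : R) <= e / 2 by rewrite ge_min lexx.
  have m2 : Num.min (e / 2) (2^-1 : R) <= 2^-1 by rewrite ge_min lexx orbT.
  rewrite oppr_eq0 gt_eqF// normrN gtr0_norm//; split => //; lra.
exists h; apply: eP => //=; first by rewrite sub0r normrN.
move=> i; rewrite !mxE eqxx/=; have [->|_] := eqVneq i j;
  first by rewrite mulr1.
by rewrite mulr0 add0r; exact: cx.
Qed.

Lemma pincr_cube (R : realType) (d : nat) (j : 'I_d) (x : 'rV[R]_d) :
  \forall h \near pincr j x, cube (h *: delta_mx ord0 j + x).
Proof. exact: near_withinT. Qed.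

(** [D c] is the candidate for the derivative taken [c i] times along each axis [i]. The induction
    hypothesis holds only on the cube, which suffices because the increments of [pincr] stay
    there. *)
Lemma pderive_seqE (R : realType) (d : nat) (D : ('I_d -> nat) -> 'rV[R]_d ->
  R) :
  (forall c j x, cube x ->
     pquot j (D c) x @ pincr j x --> D (fun i => (j == i) + c i)%N x) ->
  forall s x, cube x ->
  pderive_seq s (D (fun=> 0%N)) x = D (fun i => count_mem i s) x.
Proof.
move=> dD; elim=> [//|j s IHs] x cx.
rewrite [LHS]/= -/(pderive_seq s (D (fun=> 0%N))).
have px := pincr_proper j cx.
apply/cvg_lim => //.
apply: cvg_trans (dD (fun i => count_mem i s) j x cx).
apply: near_eq_cvg; near=> h.
rewrite /pquot !IHs//; near: h; exact: pincr_cube.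
Unshelve. all: by end_near. Qed.

Lemma pderivable_seqE (R : realType) (d : nat)
    (D : ('I_d -> nat) -> 'rV[R]_d -> R) :
  (forall c j x, cube x ->
     pquot j (D c) x @ pincr j x --> D (fun i => (j == i) + c i)%N x) ->
  forall k, has_pderivatives k (D (fun=> 0%N)).
Proof.
move=> dD k s j x _ cx; apply/cvg_ex;
  exists (D (fun i => (j == i) + count_mem i s)%N x).
apply: cvg_trans (dD (fun i => count_mem i s) j x cx).
apply: near_eq_cvg; near=> h.
rewrite /pquot !pderive_seqE//; near: h; exact: pincr_cube.
Unshelve. all: by end_near. Qed.

Lemma pderive_multiE (R : realType) (d k : nat) (p : {ffun 'I_d -> 'I_k.+1})
    (D : ('I_d -> nat) -> 'rV[R]_d -> R) :
  (forall c j x, cube x ->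
     pquot j (D c) x @ pincr j x --> D (fun i => (j == i) + c i)%N x) ->
  forall x, cube x -> pderive_multi p (D (fun=> 0%N)) x = D (fun i => p i :
    nat) x.
Proof.
move=> dD x cx; rewrite /pderive_multi pderive_seqE//; congr (D _ x).
apply/funext => i; rewrite count_flatten -map_comp sumnE big_map big_enum/=.
rewrite (bigD1 i)//= count_nseq/= eqxx mul1n big1 ?addn0// => j ji.
by rewrite count_nseq/= (negbTE ji).
Qed.

(** One formula for a tensor product plus a constant and all its partial derivatives: the indicator
    keeps [A] only when no derivative is taken. *)
Definition tensor_shift (R : realType) (d : nat) (A a : R)
    (phi : 'I_d -> nat -> R -> R) (c : 'I_d -> nat) (x : 'rV[R]_d) : R :=
  A * [forall i, c i == 0%N]%:R + a * \prod_(i < d) phi i (c i) (x ord0 i).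

(** Along axis [j] the constant cancels and only the [j]-th factor varies, so the quotient is [r]
    times a one-variable one; its two-sided limit restricts to the increments allowed by the
    cube. *)
Lemma cvg_pquot_tensor_shift (R : realType) (d : nat) (A a : R)
    (phi : 'I_d -> nat -> R -> R) :
  (forall i k (t : R), is_derive t 1 (phi i k) (phi i k.+1 t)) ->
  forall c j x, cube x ->
  pquot j (tensor_shift A a phi c) x @ pincr j x -->
  tensor_shift A a phi (fun i => (j == i) + c i)%N x.
Proof.
move=> dphi c j x cx; set r := a * \prod_(i < d | i != j) phi i (c i) (x ord0
  i).
have -> : tensor_shift A a phi (fun i => (j == i) + c i)%N x =
    r * phi j (c j).+1 (x ord0 j).
  rewrite /tensor_shift (_ : [forall i, _] = false) ?mulr0 ?add0r; last first.
    by apply/negbTE/forallPn; exists j; rewrite eqxx.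
  rewrite (bigD1 j)//= eqxx add1n /r -mulrA; congr (_ * _).
  rewrite mulrC; congr (_ * _); apply: eq_bigr => i ij.
  by rewrite eq_sym (negbTE ij).
have -> : pquot j (tensor_shift A a phi c) x = (fun h : R =>
    r * (h^-1 *: ((phi j (c j) \o shift (x ord0 j)) (h *: 1) - phi j (c j) (x
      ord0 j)))).
  apply/funext => h; rewrite /pquot /tensor_shift/=.
  rewrite (bigD1 j)//= [in X in _ - X](bigD1 j)//=.
  have -> : \prod_(i < d | i != j) phi i (c i) ((h *: delta_mx ord0 j + x) ord0
    i) =
            \prod_(i < d | i != j) phi i (c i) (x ord0 i).
    apply: eq_bigr => i ij; rewrite !mxE eqxx/= (negbTE ij) mulr0 add0r//.
  rewrite !mxE !eqxx/= mulr1 /r /GRing.scale/= mulr1; ring.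
apply: cvgZr.
have := @ex_derive _ _ _ _ _ _ _ (dphi j (c j) (x ord0 j)).
have := @derive_val _ _ _ _ _ _ _ (dphi j (c j) (x ord0 j)).
rewrite /derive => <- dj; apply: (@cvg_trans _ _ _ _ _ dj).
by apply: cvg_app; exact: cvg_within.
Qed.

(** * The two functions *)

Definition scaled_bell (R : realType) (h y : R) (k : nat) (t : R) : R :=
  bell k ((t - y) / h) * h ^- k.

Lemma is_derive_scaled_bell (R : realType) (h y : R) (k : nat) (t : R) :
  is_derive t 1 (scaled_bell h y k) (scaled_bell h y k.+1 t).
Proof.
have dl : is_derive t 1 (fun t : R => (t - y) / h) h^-1.
  have := is_derive_poly (h^-1 *: ('X - y%:P)) t.
  rewrite derivZ derivXsubC hornerZ hornerC mulr1.
  by congr is_derive; apply/funext => s; rewrite hornerZ hornerXsubC mulrC.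
have := is_deriveZ (h ^- k)
  (@is_derive1_comp _ (bell k) (fun t : R => (t - y) / h) t _ _
    (is_derive_bell k ((t - y) / h)) dl).
rewrite (_ : h ^- k *: (_ * _) = scaled_bell h y k.+1 t); last first.
  by rewrite /scaled_bell exprS invfM /GRing.scale/=; ring.
by congr is_derive; apply/funext => s; rewrite /scaled_bell mulrC.
Qed.

(** With [a = 0] this is the constant [A], so one membership lemma serves both functions of the
    comparison. *)
Definition spike (R : realType) (d : nat) (A a h : R) (y : 'rV[R]_d) :
    'rV[R]_d -> R :=
  tensor_shift A a (fun i => scaled_bell h (y ord0 i)) (fun=> 0%N).

Lemma spikeE (R : realType) (d : nat) (A a h : R) (y x : 'rV[R]_d) :
  spike A a h y x =
  A + a * \prod_(i < d) bell 0 ((x ord0 i - y ord0 i) / h).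
Proof.
rewrite /spike /tensor_shift (_ : [forall i, _] = true) ?mulr1;
  last exact/forallP.
by congr (_ + _ * _); apply: eq_bigr => i _; rewrite /scaled_bell invr1 mulr1.
Qed.

Lemma spike_ge (R : realType) (d : nat) (A a h : R) (y x : 'rV[R]_d) :
  0 <= a -> A <= spike A a h y x.
Proof.
move=> a0; rewrite spikeE lerDl mulr_ge0// prodr_ge0// => i _.
exact/ltW/bell0_gt0.
Qed.

Lemma spike_at (R : realType) (d : nat) (A a h : R) (y : 'rV[R]_d) :
  spike A a h y y = A + a * 4^-1 ^+ d.
Proof.
rewrite spikeE; congr (_ + _ * _).
under eq_bigr do rewrite subrr mul0r bell00.
by rewrite prodr_const card_ord.
Qed.

Lemma pderive_multi_spike (R : realType) (d k : nat) (p : {ffun 'I_d ->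
  'I_k.+1})
    (A a h : R) (y x : 'rV[R]_d) : cube x ->
  pderive_multi p (spike A a h y) x =
  A * (p == [ffun=> ord0])%:R +
  a * \prod_(i < d) (bell (p i) ((x ord0 i - y ord0 i) / h) * h ^- p i).
Proof.
move=> cx; rewrite /spike pderive_multiE//; last first.
  by move=> c j z cz; apply: cvg_pquot_tensor_shift => // i l t;
    exact: is_derive_scaled_bell.
rewrite /tensor_shift; congr (_ * _%:R + _); congr nat_of_bool.
apply/forallP/eqP => [p0|-> i]; last by rewrite ffunE.
by apply/ffunP => i; rewrite ffunE; apply/val_inj; exact/eqP/p0.
Qed.

(** The powers of [h^-1] from the derivatives rescale the increments [x - z], which reduces the
    remainder to that of [bell] at unit scale. *)
Lemma taylor_spike (R : realType) (d k : nat) (A a h : R) (y x z : 'rV[R]_d) :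
  cube z ->
  taylor k (spike A a h y) z x =
  A + a * \sum_(p : {ffun 'I_d -> 'I_k.+1} | (mabs p <= k)%N)
    \prod_(j < d) (bell (p j) ((z ord0 j - y ord0 j) / h) *
      (((x ord0 j - y ord0 j) / h - (z ord0 j - y ord0 j) / h) ^+ p j
       / (p j)`!%:R)).
Proof.
move=> cz; rewrite /taylor.
under eq_bigr do rewrite pderive_multi_spike// mulrDl.
rewrite big_split/=; congr (_ + _).
  rewrite (bigD1 [ffun=> ord0])/=; last by rewrite /mabs big1// => i _;
    rewrite ffunE.
  rewrite eqxx mulr1 big1 ?mulr1 => [|j _];
    last by rewrite ffunE expr0 fact0 divr1.
  by rewrite big1 ?addr0// => p /andP[_ /negbTE ->]; rewrite mulr0 mul0r.
rewrite mulr_sumr; apply: eq_bigr => p _; rewrite -mulrA; congr (_ * _).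
rewrite -big_split/=; apply: eq_bigr => j _.
rewrite -mulrBl (_ : x ord0 j - y ord0 j - _ = x ord0 j - z ord0 j);
  last by ring.
by rewrite expr_div_n; ring.
Qed.

Lemma sfloor_bounds (R : realType) (beta : R) : 0 < beta ->
  (sfloor beta)%:R < beta <= (sfloor beta).+1%:R.
Proof.
move=> b0; rewrite -sfloorP// leqnn/= leNgt -sfloorP//.
by rewrite ltnn.
Qed.

Lemma scale_le (R : realType) (eps h a beta : R) (m : nat) : 0 <= eps ->
  0 < h <= 1 -> m%:R <= beta -> 0 <= a <= eps * h `^ beta -> a * h ^- m <= eps.
Proof.
move=> e0 h01 mb /andP[a0 ah]; have /andP[h0 h1] := h01.
rewrite ler_pdivrMr ?exprn_gt0//; apply: (le_trans ah).
by rewrite ler_wpM2l// -(powR_mulrn _ (ltW h0)) ger_powR.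
Qed.

(** Up to constants, the derivatives of order [m] of the bump are at most [a h^-m] and its Taylor
    remainder has constant [a h^-beta]; with [a <= eps h^beta] both are at most of order [eps], so
    [eps] depends on neither [y] nor [h]. *)
Lemma spike_holder (R : realType) (d : nat) (beta L M A : R) : (0 < d)%N ->
  0 < beta -> 0 < L -> 0 < A -> A < M ->
  exists2 eps : R, 0 < eps & forall (y : 'rV[R]_d) (h a : R), 0 < h <= 1 ->
    0 <= a <= eps * h `^ beta -> holder_ball_ge beta L M A (spike A a h y).
Proof.
move=> d0 b0 L0 A0 AM; set k := sfloor beta.
have kb : k%:R < beta <= k.+1%:R by exact: sfloor_bounds.
have [B B1 bellB] := bell_bounded R k.+1.
have [C C0 taylorC] :=
  @tensor_taylor_bound R d k (@bell R) B beta d0 kb (@is_derive_bell R) B1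
    bellB.
have B0 : 0 < B := lt_le_trans ltr01 B1.
pose N : R := #|{ffun 'I_d -> 'I_k.+1}|%:R.
have N0 : 0 < N by rewrite ltr0n; apply/card_gt0P; exists [ffun=> ord0].
(* The first bound serves the Taylor remainder; the second serves the sum of at most [N] derivative
   bounds [eps * B ^+ d], for which the constant [A] leaves the room [M - A]. *)
exists (Num.min (L / C) ((M - A) / (N * B ^+ d))).
  by rewrite lt_min !divr_gt0// ?subr_gt0// mulr_gt0// exprn_gt0.
move=> y h a h01 aeps; set eps := Num.min _ _ in aeps.
have eL : eps * C <= L by rewrite -ler_pdivlMr// ge_min lexx.
have eM : N * (eps * B ^+ d) <= M - A.
  rewrite mulrCA -ler_pdivlMr ?mulr_gt0 ?exprn_gt0//.
  by rewrite /eps ge_min lexx orbT.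
have e0 : 0 < eps.
  by rewrite lt_min !divr_gt0// ?subr_gt0// mulr_gt0// exprn_gt0.
have /andP[h0 h1] := h01; have /andP[a0 ah] := aeps.
split; last first.
  by apply/ereal_infP => _ [x cx <-]; rewrite lee_fin spike_ge.
have dspike (c : 'I_d -> nat) j x : cube x ->
    pquot j (tensor_shift A a (fun i => scaled_bell h (y ord0 i)) c) x @ pincr
      j x -->
    tensor_shift A a (fun i => scaled_bell h (y ord0 i)) (fun i => (j == i) + c
      i)%N x.
  by move=> cx; apply: cvg_pquot_tensor_shift => // i l t;
    exact: is_derive_scaled_bell.
split.
- exact: pderivable_seqE.
- have dle (p : {ffun 'I_d -> 'I_k.+1}) : (mabs p <= k)%N ->
    (ereal_sup [set `|pderive_multi p (spike A a h y) x|%:E | x in @cube R d] <=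
     (A * (p == [ffun=> ord0])%:R + eps * B ^+ d)%:E)%E.
    move=> pk; apply: ge_ereal_sup => _ [x cx <-]; rewrite lee_fin.
    rewrite pderive_multi_spike//; apply: le_trans (ler_normD _ _) _.
    apply: lerD; first by rewrite ger0_norm// mulr_ge0// ltW.
    rewrite big_split/= prodfV prodrXr -/(mabs p) mulrA mulrAC normrM.
    apply: ler_pM => //.
      rewrite ger0_norm ?divr_ge0 ?exprn_ge0 ?(ltW h0)//.
      apply: (@scale_le _ _ _ _ beta) => //; first exact: ltW.
      by case/andP: kb => /ltW kb _; apply: le_trans kb; rewrite ler_nat.
    apply: (@le_trans _ _ (\prod_(i < d) B)).
      apply: prod_norm_le => i; apply: bellB; exact: ltnW (ltn_ord (p i)).
    by rewrite prodr_const card_ord.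
  apply: (le_trans (lee_sum _ dle)); rewrite sumEFin lee_fin big_split/=.
  rewrite (bigD1 [ffun=> ord0])/=; last by rewrite /mabs big1// => i _;
    rewrite ffunE.
  rewrite eqxx mulr1 big1 ?addr0 => [|p /andP[_ /negbTE ->]];
    last by rewrite mulr0.
  rewrite -lerBrDl; apply: le_trans eM; apply: sum_le_card => //.
  by rewrite mulr_ge0 ?exprn_ge0// ltW.
- move=> x z cx cz; rewrite taylor_spike// spikeE.
  rewrite opprD addrACA subrr add0r -mulrBr normrM ger0_norm//.
  apply: le_trans (ler_wpM2l a0 (taylorC _ _)) _.
  under eq_bigr => j _.
    rewrite -mulrBl (_ : x ord0 j - y ord0 j - _ = x ord0 j - z ord0 j);
      last by ring.
    rewrite normrM (@ger0_norm _ h^-1) ?invr_ge0 ?(ltW h0)// powRM ?invr_ge0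
      ?(ltW h0)//.
    over.
  rewrite -mulr_suml; set S := \sum_(j < d) _.
  have S0 : 0 <= S by rewrite sumr_ge0// => j _; exact: powR_ge0.
  have -> : a * (C * (S * h^-1 `^ beta)) = a * h^-1 `^ beta * C * S by ring.
  apply: ler_wpM2r => //; apply: le_trans eL; rewrite ler_wpM2r ?(ltW C0)//.
  have hb : h `^ beta * h^-1 `^ beta = 1.
    by rewrite -powRM ?invr_ge0 ?(ltW h0)// divff ?gt_eqF// powR1.
  apply: (le_trans (ler_wpM2r (powR_ge0 _ _) ah)).
  by rewrite -mulrA hb mulr1.
Qed.

(** * Risk bounds *)

Lemma sum_design (R : realType) (d m : nat) (F : 'I_d -> R -> R) :
  \sum_(i < m ^ d) \prod_(j < d) F j (design R i ord0 j) =
  \prod_(j < d) \sum_(k < m) F j (k.+1%:R / m%:R).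
Proof.
rewrite bigA_distr_bigA (reindex (fun i : 'I_(m ^ d) =>
    enum_val (cast_ord (esym (card_grid d m)) i) : {ffun 'I_d -> 'I_m}))/=.
  by apply: eq_bigr => i _; apply: eq_bigr => j _; rewrite mxE.
exists (fun g => cast_ord (card_grid d m) (enum_rank g)) => x _.
  by rewrite enum_valK cast_ordKV.
by rewrite cast_ordK enum_rankK.
Qed.

(** * The bandwidth and the sum of the bump over the grid *)

Definition bandwidth (R : realType) (d : nat) (beta : R) (n : nat) : R :=
  n%:R `^ (- (beta + d%:R)^-1).

Lemma bandwidth01 (R : realType) (d : nat) (beta : R) (n : nat) :
  0 < beta -> (0 < n)%N -> 0 < bandwidth d beta n <= 1.
Proof.
move=> b0 n0; rewrite powR_gt0 ?ltr0n//= -(powRr0 (n%:R : R)).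
by rewrite ler_powR ?ler1n// oppr_le0 invr_ge0 addr_ge0// ltW.
Qed.

Lemma rate_bandwidth (R : realType) (d : nat) (beta : R) (n : nat) :
  rate d beta n = bandwidth d beta n `^ beta.
Proof. by rewrite /rate /bandwidth -powRrM mulNr mulrC. Qed.

Lemma bandwidth_balance (R : realType) (d : nat) (beta : R) (n : nat) :
  0 < beta -> (0 < n)%N ->
  bandwidth d beta n `^ beta * bandwidth d beta n ^+ d = n%:R^-1.
Proof.
move=> b0 n0; have /andP[h0 _] := bandwidth01 d b0 n0.
rewrite -(powR_mulrn _ (ltW h0)) -powRD; last by rewrite (gt_eqF h0) implybT.
rewrite /bandwidth -powRrM mulNr mulVf ?powR_inv1//.
by rewrite gt_eqF// ltr_wpDr.
Qed.

(** The product is [m] to the power [beta / (beta + d)]. So the mesh [1/m] is at most the bandwidth,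
    and the rescaled grid has step at most 1, as [bell_sum_le] requires. *)
Lemma grid_bandwidth (R : realType) (d m : nat) (beta : R) :
  0 < beta -> (0 < m)%N -> 1 <= m%:R * bandwidth d beta (m ^ d).
Proof.
move=> b0 m0; rewrite /bandwidth natrX -powR_mulrn// -powRrM.
have mE : (m%:R : R) = m%:R `^ 1 by rewrite powRr1.
rewrite {1}mE -powRD; last by rewrite pnatr_eq0 -lt0n m0 implybT.
have bd : 0 < beta + d%:R by rewrite ltr_wpDr.
rewrite -[leLHS](powRr0 (m%:R : R)) ler_powR ?ler1n// mulrN subr_ge0.
by rewrite ler_pdivrMr// mul1r lerDr ltW.
Qed.

Lemma sum_spike_design (R : realType) (d m : nat) (beta h : R) (y : 'rV[R]_d) :
  0 < beta -> (0 < m)%N -> h = bandwidth d beta (m ^ d) ->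
  h `^ beta * (\sum_(i < m ^ d)
    \prod_(j < d) bell 0 ((design R i ord0 j - y ord0 j) / h)) <= 2 ^+ d.
Proof.
move=> b0 m0 hE; rewrite (sum_design m (fun j t => bell 0 ((t - y ord0 j) /
  h))).
have n0 : (0 < m ^ d)%N by rewrite expn_gt0 m0.
have /andP[h0 h1] : 0 < h <= 1 by rewrite hE bandwidth01.
have mh : 1 <= m%:R * h by rewrite hE grid_bandwidth.
have m0' : 0 < m%:R :> R by rewrite ltr0n.
have mh0 : 0 < m%:R * h by rewrite mulr_gt0.
have s01 : 0 < (m%:R * h)^-1 <= 1 by rewrite invr_gt0 mh0/= invf_le1.
apply: (@le_trans _ _ (h `^ beta * \prod_(j < d) (2 * (m%:R * h)))).
  rewrite ler_wpM2l ?powR_ge0//; apply: ler_prod => j _.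
  rewrite sumr_ge0 => [|k _]/=; last exact/ltW/bell0_gt0.
  (* The grid starts at [1/m] and not at 0, hence this first term; after division by the bandwidth
     its step is [1 / (m h)]. *)
  have := @bell_sum_le R ((m%:R^-1 - y ord0 j) / h) (m%:R * h)^-1 m s01.
  rewrite invrK; apply: le_trans; apply: ler_sum => k _.
  rewrite le_eqVlt; apply/orP; left; apply/eqP; congr (bell 0 _);
    rewrite -(@natr1 R k).
  by field; rewrite !gt_eqF.
have -> : h `^ beta * \prod_(j < d) (2 * (m%:R * h)) =
    h `^ beta * h ^+ d * m%:R ^+ d * 2 ^+ d.
  by rewrite prodr_const card_ord !exprMn; ring.
rewrite hE bandwidth_balance// natrX mulVf ?mul1r//.
by rewrite expf_neq0// gt_eqF.
Qed.

(** Factor by factor, from [1 + t <= exp t] at [t = g i / A]. *)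
Lemma prod_ratio_ge (R : realType) (n : nat) (A : R) (g : 'I_n -> R) :
  0 < A -> (forall i, 0 <= g i) ->
  expR (- ((\sum_(i < n) g i) / A)) <= \prod_(i < n) (A / (A + g i)).
Proof.
move=> A0 g0; rewrite -mulNr -sumrN mulr_suml expR_sum.
apply: ler_prod => i _; rewrite expR_ge0/= mulNr expRN.
have -> : A / (A + g i) = (1 + g i / A)^-1.
  by field; rewrite !gt_eqF// ltr_wpDr.
rewrite lef_pV2 ?posrE ?expR_gt0 ?expR_ge1Dx//.
by rewrite ltr_wpDr// divr_ge0// ltW.
Qed.

(** By the triangle inequality, the larger of the distances from [v] to [a] and [b] is at least half
    of [|b - a|]. *)
Lemma two_point_powR (R : realType) (q a b v : R) : 0 <= q ->
  (`|b - a| / 2) `^ q <= `|v - a| `^ q + `|v - b| `^ q.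
Proof.
move=> q0; have : `|b - a| <= `|v - a| + `|v - b|.
  by rewrite (_ : b - a = (v - a) - (v - b)) ?ler_normB//; ring.
have [ab|/ltW ab] := leP `|v - b| `|v - a| => tri.
  apply: ler_wpDr; first exact: powR_ge0.
  apply: ge0_ler_powR; rewrite ?nnegrE ?divr_ge0// ler_pdivrMr//; lra.
apply: ler_wpDl; first exact: powR_ge0.
apply: ge0_ler_powR; rewrite ?nnegrE ?divr_ge0// ler_pdivrMr//; lra.
Qed.

(** Both risks are moved to the law under [f0] at the price of the factor [c]: by domination of laws
    for [f1], and simply because [c <= 1] for [f0]. *)
Lemma two_point_risk (dT : measure_display) (T : measurableType dT)
    (R : realType) (P : probability T R) (d m : nat)
    (U : 'I_(m ^ d) -> {RV P >-> R}) (q c : R) (y : 'rV[R]_d)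
    (F : set ('rV[R]_d -> R)) (f0 f1 : 'rV[R]_d -> R) :
  mutually_independent U -> (forall i, uniform01 (U i)) -> 0 <= q ->
  F f0 -> F f1 ->
  (forall i : 'I_(m ^ d), 0 < f0 (design R i) <= f1 (design R i)) ->
  0 <= c -> c <= \prod_(i < m ^ d) (f0 (design R i) / f1 (design R i)) ->
  ((c / 2 * (`|f1 y - f0 y| / 2) `^ q)%:E <= minimax_risk U q y F)%E.
Proof.
move=> indU unifU q0 Ff0 Ff1 f01 c0 cle; apply/ereal_infP => _ [t mt <-].
set S := max_risk _ _ _ _ _; set D := (_ `^ q).
pose loss (f : 'rV[R]_d -> R) (v : (m ^ d).-tuple R) := `|t v - f y| `^ q.
have mloss f : measurable_fun setT (loss f).
  apply: (measurableT_comp (measurable_powR q)).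
  apply: (measurableT_comp (@normr_measurable R setT)).
  by apply: measurable_funB => //; exact: measurable_cst.
have loss0 f v : 0 <= loss f v by exact: powR_ge0.
pose V (f : 'rV[R]_d -> R) := scaled U (fun i : 'I_(m ^ d) => f (design R i)).
have mV f : measurable_fun setT (V f) by exact: measurable_scaled.
have riskS f : F f -> ('E_P[(loss f \o V f)%R] <= S)%E.
  by move=> Ff; apply: ereal_sup_ubound; exists f.
have c1 : c <= 1.
  apply: (le_trans cle); apply: (@le_trans _ _ (\prod_(i < m ^ d) 1));
    last by rewrite big1.
  apply: ler_prod => i _; have /andP[a0 ab] := f01 i.
  have b0 := lt_le_trans a0 ab.
  by rewrite divr_ge0 ?(ltW a0) ?(ltW b0)//= ler_pdivrMr// mul1r.
have E0 f g : (0 <= 'E_P[(loss f \o V g)%R])%E.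
  by rewrite unlock; apply: integral_ge0 => w _; rewrite lee_fin; exact: loss0.
have risk1 : (c%:E * 'E_P[(loss f1 \o V f0)%R] <= S)%E.
  apply: le_trans (riskS _ Ff1); apply: le_trans; last first.
    apply: (expectation_dominated indU unifU f01 (mloss f1)) => v; exact: loss0.
  by rewrite lee_wpmul2r// lee_fin.
have risk0 : (c%:E * 'E_P[(loss f0 \o V f0)%R] <= S)%E.
  apply: le_trans (riskS _ Ff0); rewrite -[leRHS]mul1e.
  by rewrite lee_wpmul2r// lee_fin.
(* Under this common law the two losses add up pointwise to at least [D]; the 1/2 in [c / 2] comes
   from [S + S]. *)
have : ((c * D)%:E <= S + S)%E.
  apply: le_trans (leeD risk0 risk1).
  rewrite -ge0_muleDr// EFinM lee_wpmul2l ?lee_fin//.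
  rewrite unlock -ge0_integralD//; last 4 first.
  - by move=> w _; rewrite lee_fin; exact: loss0.
  - by apply/measurable_EFinP; exact: measurableT_comp.
  - by move=> w _; rewrite lee_fin; exact: loss0.
  - by apply/measurable_EFinP; exact: measurableT_comp.
  apply: (@le_trans _ _ (\int[P]_w D%:E)%E).
    by rewrite integral_cst//= probability_setT mule1.
  apply: ge0_le_integral => //.
  - by move=> w _; rewrite lee_fin; exact: powR_ge0.
  - apply: emeasurable_funD; apply/measurable_EFinP; exact: measurableT_comp.
  - by move=> w _; rewrite -EFinD lee_fin; exact: two_point_powR.
case: S {riskS risk0 risk1} => [s| |]; [|by rewrite !leey|by rewrite !leeNy_eq].
rewrite -EFinD !lee_fin mulrAC ler_pdivrMr//; lra.
Qed.

Lemma limn_einf_ge (R : realType) (u : (\bar R)^nat) (K : \bar R) :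
  (forall n, (K <= u n)%E) -> (K <= limn_einf u)%E.
Proof.
move=> Ku; rewrite limn_einf_lim; apply: lime_ge; first exact: is_cvg_einfs.
by apply: nearW => n; apply/ereal_infP => _ [k _ <-].
Qed.

Theorem theorem2p1 (R : realType) (d : nat) (beta L M A q : R)
    (y : 'rV[R]_d)
    (dO : nat -> measure_display)
    (Omega : forall m : nat, measurableType (dO m))
    (P : forall m : nat, probability (Omega m) R)
    (U : forall m : nat, 'I_(m ^ d) -> {RV (P m) >-> R})
    (Uindep : forall m : nat, mutually_independent (U m))
    (Uunif : forall (m : nat) (i : 'I_(m ^ d)), uniform01 (U m i))
    (hd : (1 <= d)%N) (hbeta : 0 < beta) (hL : 0 < L)
    (hA : 0 < A) (hAM : A < M) (hq : 1 <= q) (hy : cube y) :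
  (0 < limn_einf (fun m : nat =>
         ((rate d beta (m.+1 ^ d)) `^ (- q))%:E *
         minimax_risk (U m.+1) q y (holder_ball_ge beta L M A)))%E.
Proof.
have q0 : 0 <= q := le_trans ler01 hq.
have [eps eps0 holder] := spike_holder hd hbeta hL hA hAM.
(* The sum of [f1 - f0] over the grid will be at most [eps * 2 ^+ d], so [c] bounds the product of
   ratios from below for every grid size. *)
pose c := expR (- (eps * 2 ^+ d / A)).
(* [bell 0] equals 1/4 at 0, so [f1 y - f0 y] is [delta] times the rate. *)
pose delta := eps * 4^-1 ^+ d.
have delta0 : 0 < delta by rewrite mulr_gt0// exprn_gt0.
pose K := c / 2 * (delta / 2) `^ q.
have K0 : 0 < K by rewrite mulr_gt0 ?divr_gt0 ?expR_gt0// powR_gt0// divr_gt0.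
apply: (@lt_le_trans _ _ K%:E); first by rewrite lte_fin.
(* The normalized risk is at least [K] for every grid size, not only in the limit. *)
apply: limn_einf_ge => m.
pose h : R := bandwidth d beta (m.+1 ^ d).
have n0 : (0 < m.+1 ^ d)%N by rewrite expn_gt0.
have h01 : 0 < h <= 1 by exact: bandwidth01.
rewrite rate_bandwidth -/h; set r := h `^ beta.
have r0 : 0 < r by rewrite powR_gt0//; case/andP: h01.
pose f0 := spike A 0 h y; pose f1 := spike A (eps * r) h y.
have er0 : 0 <= eps * r by rewrite mulr_ge0 ?ltW.
have f0E x : f0 x = A by rewrite /f0 spikeE mul0r addr0.
have risk : ((c / 2 * (`|f1 y - f0 y| / 2) `^ q)%:E <=
    minimax_risk (U m.+1) q y (holder_ball_ge beta L M A))%E.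
  apply: (@two_point_risk _ _ _ _ _ _ _ _ _ _ _ f0 f1) => //.
  - by apply: holder => //; rewrite lexx.
  - by apply: holder => //; rewrite er0 lexx.
  - by move=> i; rewrite f0E hA spike_ge.
  - exact: expR_ge0.
  - under eq_bigr do rewrite f0E /f1 spikeE.
    apply: le_trans (prod_ratio_ge hA _); last first.
      by move=> i; rewrite mulr_ge0// prodr_ge0// => j _; exact/ltW/bell0_gt0.
    rewrite ler_expR lerN2 ler_wpM2r ?invr_ge0 ?(ltW hA)//.
    rewrite -mulr_sumr -mulrA ler_wpM2l ?(ltW eps0)//.
    exact: sum_spike_design.
apply: le_trans (lee_wpmul2l _ risk); last by rewrite lee_fin powR_ge0.
rewrite f0E /f1 spike_at addrAC subrr add0r -EFinM lee_fin.
have -> : eps * r * 4^-1 ^+ d = delta * r by rewrite /delta mulrAC.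
rewrite ger0_norm ?(mulr_ge0 (ltW delta0) (ltW r0))//.
rewrite [delta * r / 2]mulrAC powRM ?divr_ge0 ?(ltW delta0) ?(ltW r0)//.
have rq0 : r `^ q != 0 by exact: lt0r_neq0 (powR_gt0 q r0).
rewrite powRN le_eqVlt; apply/orP; left; apply/eqP; rewrite /K.
by field.
Qed.
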